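(* Let $S$ be a Dedekind domain, let $A \unlhd S$ be an ideal of $S$ and let $R = S/A$. Then the multiplicative semigroup of $R$ is a semilattice $\mathcal{S}[E(D); R_e]$ of stratified extensions of groups; that is, $R$ is the disjoint union of the subsemigroups $R_e$ ($e \in E(D)$), $R_eR_f \subseteq R_{ef}$ for all $e,f\in E(D)$, and each $R_e$ is a stratified extension of a group.
   Context: For a semigroup $T$, $\mathrm{Base}(T) = \bigcap_{m>0} T^m$, where $T^m$ is the set of all products of $m$ elements of $T$. $T$ is a stratified extension of $\mathrm{Base}(T)$ if $\mathrm{Base}(T)\neq\emptyset$; so $T$ is a stratified extension of a group if $\mathrm{Base}(T)$ is non-empty and is a group under the multiplication of $T$. A semigroup $T$ is a semilattice of semigroups $T_\alpha$ ($\alpha\in Y$), written $T=\mathcal{S}[Y;T_\alpha]$, if $Y$ is a semilattice (commutative semigroup of idempotents), $T$ is the disjoint union of the non-empty subsemigroups $T_\alpha$, and $T_\alpha T_\beta\subseteq T_{\alpha\beta}$ for all $\alpha,\beta\in Y$. For the commutative ring $R$ with unity: $D$ is the set of all ideals of $R$, a commutative semigroup under ideal multiplication; $E(D)$ is the semilattice of idempotent ideals (those $J$ with $J^2=J$); $\delta:R\to D$ is $\delta(x)=(x)$, the principal ideal generated by $x$; $\varepsilon: D\to E(D)$ sends $I$ to $\varepsilon(I)=\sum\{J : J\in E(D), J\subseteq I\}$, the largest idempotent ideal contained in $I$; and for $e\in E(D)$, $R_e = (\varepsilon\delta)^{-1}(e) = \{x\in R : \varepsilon((x)) = e\}$. 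*)

(* Defs.v *)
From HB Require Import structures.
From mathcomp Require Import all_boot all_order all_algebra.
From mathcomp Require Import boolp classical_sets.

Set Implicit Arguments.
Unset Strict Implicit.
Unset Printing Implicit Defensive.

Import GRing.Theory.
Local Open Scope classical_set_scope.
Local Open Scope ring_scope.
Local Open Scope quotient_scope.

Section Semigroups.
Local Open Scope group_scope.
Variable T : semigroupType.
Implicit Types (X G : set T) (m : nat).

(* X^m for m > 0; the value at m = 0 is the empty set and is never used. *)
Definition setpow X m : set T :=
  [set x | exists a s, [/\ size (a :: s) = m,
                           {in a :: s, forall y, X y} &
                           x = foldl *%g a s]].

Definition Base X : set T := \bigcap_(m in [set m | (0 < m)%N]) setpow X m.

Definition subsemigroup X : Prop := forall x y, X x -> X y -> X (x * y).

Definition subset_group G : Prop :=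
  subsemigroup G /\
  exists2 e, G e & forall x, G x ->
    [/\ e * x = x, x * e = x &
        exists2 y, G y & x * y = e /\ y * x = e].

Definition stratified_extension_of_group X : Prop :=
  Base X !=set0 /\ subset_group (Base X).

Definition idempotents : set T := [set e | e * e = e].

Definition semilattice (Y : set T) : Prop :=
  [/\ subsemigroup Y,
      forall a b, Y a -> Y b -> a * b = b * a &
      forall a, Y a -> a * a = a].

End Semigroups.

Arguments idempotents : clear implicits.

Definition semilattice_of_semigroups (T P : semigroupType) (Y : set P)
    (F : P -> set T) : Prop :=
  semilattice Y /\
  [/\ \bigcup_(a in Y) F a = [set: T],
      trivIset Y F,
      forall a, Y a -> F a !=set0 /\ subsemigroup (F a) &
      forall a b, Y a -> Y b -> forall x y, F a x -> F b y ->
        F (a * b)%g (x * y)%g].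

(* The carrier of R, seen as a multiplicative semigroup. *)
Definition mult_semigroup (R : comPzRingType) : Type := R.

HB.instance Definition _ (R : comPzRingType) :=
  Choice.on (mult_semigroup R).
HB.instance Definition _ (R : comPzRingType) :=
  isSemigroup.Build (mult_semigroup R) (@mulrA R).

Definition is_ideal (R : comPzRingType) (I : set R) : Prop :=
  [/\ I 0, forall x y, I x -> I y -> I (x + y) &
      forall r x, I x -> I (r * x)].

Record ideal (R : comPzRingType) := Ideal {
  ideal_set :> R -> Prop;
  ideal_setP : is_ideal ideal_set }.

HB.instance Definition _ (R : comPzRingType) := gen_eqMixin (ideal R).
HB.instance Definition _ (R : comPzRingType) := gen_choiceMixin (ideal R).

Section Ideals.
Variable R : comPzRingType.
Implicit Types (I J K : ideal R) (X : set R) (F : set (ideal R)).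

Lemma ideal0 I : I 0. Proof. by have [] := ideal_setP I. Qed.

Lemma idealD I x y : I x -> I y -> I (x + y).
Proof. by have [_ h _] := ideal_setP I; exact: h. Qed.

Lemma idealMl I r x : I x -> I (r * x).
Proof. by have [_ _ h] := ideal_setP I; exact: h. Qed.

Lemma idealMr I r x : I x -> I (x * r).
Proof. by rewrite mulrC; exact: idealMl. Qed.

Lemma ideal_eqP I J : I `<=>` J -> I = J.
Proof.
case: I J => [X hX] [Y hY] [/= h1 h2].
have E : X = Y by apply/seteqP.
by rewrite E in hX *; congr Ideal; exact: Prop_irrelevance.
Qed.

Lemma smallest_is_ideal X : is_ideal (smallest (@is_ideal R) X).
Proof.
split=> [M [[]] //|x y hx hy M hM|r x hx M hM].
- by case: (hM) => -[_ h _] _; apply: h; [exact: hx|exact: hy].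
- by case: (hM) => -[_ _ h] _; apply: h; exact: hx.
Qed.

Definition gen_ideal X : ideal R := Ideal (smallest_is_ideal X).

Lemma sub_gen_ideal X : X `<=` gen_ideal X.
Proof. exact: sub_gen_smallest. Qed.

Lemma gen_ideal_sub X I : X `<=` I -> gen_ideal X `<=` I.
Proof. by apply: smallest_sub; exact: ideal_setP. Qed.

Definition principal (x : R) : ideal R := gen_ideal [set x].

Definition mul_ideal I J : ideal R :=
  gen_ideal [set x * y | x in I & y in J].

Lemma mem_mul_ideal I J x y : I x -> J y -> mul_ideal I J (x * y).
Proof. by move=> Ix Jy; apply: sub_gen_ideal; exists x => //; exists y. Qed.

Lemma mul_ideal_sub I J K :
  (forall x y, I x -> J y -> K (x * y)) -> mul_ideal I J `<=` K.
Proof. by move=> h; apply: gen_ideal_sub => _ [x Ix [y Jy <-]]; exact: h. Qed.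

Lemma is_ideal_colon K r : is_ideal [set x | K (r * x)].
Proof.
split=> [|x y /= hx hy|s x /= hx].
- by rewrite /= mulr0; exact: ideal0.
- by rewrite mulrDr; exact: idealD.
- by rewrite mulrCA; exact: idealMl.
Qed.

Lemma mul_idealC : commutative mul_ideal.
Proof.
move=> I J; apply: ideal_eqP; split; apply: mul_ideal_sub => x y hx hy;
  by rewrite mulrC; exact: mem_mul_ideal.
Qed.

Lemma mul_ideal_assoc_sub I J K :
  mul_ideal I (mul_ideal J K) `<=` mul_ideal (mul_ideal I J) K.
Proof.
apply: mul_ideal_sub => x y Ix.
set L := Ideal (is_ideal_colon (mul_ideal (mul_ideal I J) K) x).
apply: (mul_ideal_sub (K := L)) y => y z Jy Kz.
change (mul_ideal (mul_ideal I J) K (x * (y * z))).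
by rewrite mulrA; apply: mem_mul_ideal => //; exact: mem_mul_ideal.
Qed.

Lemma mul_idealA : associative mul_ideal.
Proof.
move=> I J K; apply: ideal_eqP; split; first exact: mul_ideal_assoc_sub.
rewrite mul_idealC (mul_idealC I J) (mul_idealC I (mul_ideal J K)).
by rewrite (mul_idealC J K); exact: mul_ideal_assoc_sub.
Qed.

Lemma sum_is_ideal F :
  is_ideal [set x | exists2 s : seq R,
    {in s, forall y, exists2 J, F J & J y} & x = \sum_(y <- s) y].
Proof.
split=> /= [|x y [s hs ->] [t ht ->]|r x [s hs ->]].
- by exists [::]; rewrite ?big_nil.
- exists (s ++ t); last by rewrite big_cat.
  by move=> z; rewrite mem_cat => /orP[]; [exact: hs|exact: ht].
- exists [seq r * y | y <- s]; last by rewrite big_map mulr_sumr.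
  move=> _ /mapP[y ys ->]; have [J FJ Jy] := hs y ys.
  by exists J => //; exact: idealMl.
Qed.

Definition sum_ideal F : ideal R := Ideal (sum_is_ideal F).

End Ideals.

HB.instance Definition _ (R : comPzRingType) :=
  isSemigroup.Build (ideal R) (@mul_idealA R).

Section LargestIdempotentIdeal.
Variable R : comPzRingType.
Implicit Types I J : ideal R.

Definition eps I : ideal R :=
  sum_ideal [set J | idempotents (ideal R) J /\ J `<=` I].

Lemma eps_sub I : eps I `<=` I.
Proof.
move=> _ [s hs ->]; rewrite big_seq; elim/big_ind: _.
- exact: ideal0.
- by move=> x y; exact: idealD.
- by move=> y /hs[J [_ JI] /JI].
Qed.

Lemma eps_max I J : idempotents (ideal R) J -> J `<=` I -> J `<=` eps I.
Proof.
move=> EJ JI x Jx; exists [:: x]; last by rewrite big_seq1.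
by move=> y; rewrite inE => /eqP ->; exists J.
Qed.

Lemma eps_idempotent I : idempotents (ideal R) (eps I).
Proof.
apply: ideal_eqP; split.
  by apply: mul_ideal_sub => x y _; exact: idealMl.
move=> _ [s hs ->]; rewrite big_seq; elim/big_ind: _.
- exact: ideal0.
- by move=> x y; exact: idealD.
- move=> y /hs[J [EJ JI] Jy].
  rewrite -EJ in Jy; move: y Jy.
  by apply: mul_ideal_sub => x y Jx Jy; apply: mem_mul_ideal;
    exact: (eps_max EJ JI).
Qed.

Definition eps_class (e : ideal R) : set (mult_semigroup R) :=
  [set x | eps (principal x) = e].

End LargestIdempotentIdeal.

Section QuotientRing.
Variables (R : comPzRingType) (A : ideal R).

Definition ideal_pred : R -> bool := fun x => `[< A x >].

Lemma ideal_predP x : reflect (A x) (x \in ideal_pred).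
Proof. exact: asboolP. Qed.

Lemma ideal_pred_zmod_closed : zmod_closed ideal_pred.
Proof.
split; first by apply/ideal_predP; exact: ideal0.
move=> x y /ideal_predP Ax /ideal_predP Ay; apply/ideal_predP.
by apply: idealD => //; rewrite -mulN1r; exact: idealMl.
Qed.

HB.instance Definition _ :=
  GRing.isZmodClosed.Build R ideal_pred ideal_pred_zmod_closed.

Definition ideal_zmodClosed : zmodClosed R :=
  GRing.ZmodClosed.clone R ideal_pred _.

(* The library makes {quot I} a ring only for proper ideals I; here the ring
   structure is also provided for A = R, when the quotient is the zero ring. *)
Definition quotient_ring : Type := Quotient.quot ideal_zmodClosed.

HB.instance Definition _ := GRing.Zmodule.on quotient_ring.

Definition qpi (x : R) : quotient_ring := \pi_(Quotient.quot ideal_zmodClosed) x.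

Lemma qpi_eqP x y : qpi x = qpi y <-> A (x - y).
Proof.
by split=> [/eqP|h]; [|apply/eqP]; rewrite -Quotient.idealrBE; apply/ideal_predP.
Qed.

Lemma qpi_surj (u : quotient_ring) : exists x, qpi x = u.
Proof. by exists (repr u); exact: reprK. Qed.

Definition qmul (u v : quotient_ring) : quotient_ring :=
  qpi (repr u * repr v).

Lemma qpiM x y : qpi (x * y) = qmul (qpi x) (qpi y).
Proof.
apply/qpi_eqP; set x' := repr _; set y' := repr _.
have hx : A (x - x') by apply/qpi_eqP; rewrite /qpi reprK.
have hy : A (y - y') by apply/qpi_eqP; rewrite /qpi reprK.
rewrite -[x * y](addrNK (x * y')) -addrA -mulrBr -mulrBl.
by apply: idealD; [exact: idealMl|exact: idealMr].
Qed.

Lemma qpiD x y : qpi (x + y) = qpi x + qpi y.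
Proof. exact: (raddfD (\pi_(Quotient.quot ideal_zmodClosed))). Qed.

Lemma qmulA : associative qmul.
Proof.
move=> u v w; have [[x <-] [y <-]] := (qpi_surj u, qpi_surj v).
by have [z <-] := qpi_surj w; rewrite -!qpiM mulrA.
Qed.

Lemma qmulC : commutative qmul.
Proof. by move=> u v; rewrite /qmul mulrC. Qed.

Lemma qmul1 : left_id (qpi 1) qmul.
Proof. by move=> u; have [x <-] := qpi_surj u; rewrite -qpiM mul1r. Qed.

Lemma qmulDl : left_distributive qmul +%R.
Proof.
move=> u v w; have [[x <-] [y <-]] := (qpi_surj u, qpi_surj v).
by have [z <-] := qpi_surj w; rewrite -qpiD -!qpiM -qpiD mulrDl.
Qed.

HB.instance Definition _ :=
  GRing.Zmodule_isComPzRing.Build quotient_ring qmulA qmulC qmul1 qmulDl.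

End QuotientRing.

Definition noetherian (R : comPzRingType) : Prop :=
  forall I : ideal R, exists s : seq R, I = gen_ideal [set` s].

Definition prime_ideal (R : comPzRingType) (P : ideal R) : Prop :=
  ~ P 1 /\ forall x y, P (x * y) -> P x \/ P y.

Definition maximal_ideal (R : comPzRingType) (M : ideal R) : Prop :=
  ~ M 1 /\ forall J : ideal R, M `<=` J -> ~ J 1 -> J = M.

Definition integrally_closed (S : idomainType) : Prop :=
  forall z : {fraction S}, integralOver (@tofrac S) z ->
    exists x : S, z = tofrac x.

(* Fields are allowed. *)
Definition dedekind_domain (S : idomainType) : Prop :=
  [/\ noetherian S, integrally_closed S &
      forall P : ideal S, prime_ideal P -> (exists2 x, P x & x != 0) ->
        maximal_ideal P].

(* Main.v *)
(** Write R = S/A. For every nonzero x in R the ring R/(x) has finite length;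
    this is recorded by a natural-valued function on ideals which decreases
    strictly along strict inclusions of ideals containing x. By noetherian
    induction in S: if B is a nonzero ideal which is not prime, say ab in B with
    a, b outside B, then ideals I <= J with I + (a) = J + (a) and I : a = J : a
    are equal, so the lengths above the strictly larger ideals B + (a) and B : a
    add up to one for B; a nonzero prime B is maximal.

    An idempotent ideal of R is generated by an idempotent f (Nakayama), and f
    is the identity of the group Base(R_e), e = (f). The point is that
    y = (1 - f) x vanishes for x in Base(R_e). Otherwise factor x into more
    elements of R_e than the length of R/(y) allows: some partial product p of y
    satisfies p = p b r with b in R_e, hence lies in every (b^n). As R/(p) has
    finite length the (b^n) stabilise, at an idempotent ideal, which is then
    contained in eps((b)) = (f); so p = (1 - f) p = 0. *)

From Pilot Require Import Defs.
From HB Require Import structures.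
From mathcomp Require Import all_boot all_order all_algebra.
From mathcomp Require Import boolp classical_sets.
From mathcomp Require Import ring.

Section Development.
Set Implicit Arguments.
Unset Strict Implicit.
Unset Printing Implicit Defensive.
(* Restores [idealMr], which mathcomp shadows. *)
Import GRing.Theory Pilot.Defs.
Local Open Scope classical_set_scope.
Local Open Scope ring_scope.

(** * Principal ideals, products of ideals, and [eps] *)

Lemma mem_principal (R : comPzRingType) (x y : R) :
  principal x y <-> exists r, y = r * x.
Proof.
have idl : is_ideal [set z : R | exists r, z = r * x].
  split=> [|_ _ [r ->] [s ->]|r _ [s ->]].
  - by exists 0; rewrite mul0r.
  - by exists (r + s); rewrite mulrDl.
  - by exists (r * s); rewrite mulrA.
split; last by move=> [r ->]; apply: idealMl; exact: sub_gen_ideal.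
apply: (@gen_ideal_sub _ _ (Ideal idl)) => _ ->.
by exists 1; rewrite mul1r.
Qed.

Lemma principal_id (R : comPzRingType) (x : R) : principal x x.
Proof. exact: sub_gen_ideal. Qed.
Arguments principal_id {R} x.

Lemma principal_sub (R : comPzRingType) (x : R) (I : ideal R) :
  I x -> principal x `<=` I.
Proof. by move=> Ix; apply: gen_ideal_sub => _ ->. Qed.

Lemma idealB (R : comPzRingType) (I : ideal R) (x y : R) :
  I x -> I y -> I (x - y).
Proof. by move=> Ix Iy; apply: idealD => //; rewrite -mulN1r; exact: idealMl. Qed.

Lemma mul_principal (R : comPzRingType) (x y : R) :
  mul_ideal (principal x) (principal y) = principal (x * y).
Proof.
apply: ideal_eqP; split.
  apply: mul_ideal_sub => _ _ /mem_principal[r ->] /mem_principal[s ->].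
  by apply/mem_principal; exists (r * s); rewrite mulrACA.
by apply: principal_sub; apply: mem_mul_ideal; exact: principal_id.
Qed.

Lemma mul_ideal_subl (R : comPzRingType) (I J : ideal R) :
  mul_ideal I J `<=` I.
Proof. apply: mul_ideal_sub => x y Ix _. exact: idealMr.
Qed.

Lemma mul_ideal_mono (R : comPzRingType) (I I' J J' : ideal R) :
  I `<=` I' -> J `<=` J' -> mul_ideal I J `<=` mul_ideal I' J'.
Proof.
move=> II' JJ'; apply: mul_ideal_sub => x y Ix Jy.
by apply: mem_mul_ideal; [exact: II'|exact: JJ'].
Qed.

Lemma eps_mono (R : comPzRingType) (I J : ideal R) :
  I `<=` J -> eps I `<=` eps J.
Proof.
move=> IJ; apply: eps_max; first exact: eps_idempotent.
exact: subset_trans (@eps_sub _ I) IJ.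
Qed.

Lemma idempotentsP (R : comPzRingType) (I : ideal R) :
  idempotents (ideal R) I <-> mul_ideal I I = I.
Proof. by []. Qed.

Lemma mul_idempotents (R : comPzRingType) (I J : ideal R) :
  idempotents (ideal R) I -> idempotents (ideal R) J ->
  idempotents (ideal R) (mul_ideal I J).
Proof.
move=> /idempotentsP EI /idempotentsP EJ; apply/idempotentsP.
by rewrite mul_idealA -(mul_idealA I) (mul_idealC J) mul_idealA EI -mul_idealA EJ.
Qed.

(** [eps (mul_ideal I J)] is its own square, and by monotonicity the two factors lie in [eps I] and
    [eps J]; conversely a product of idempotent ideals is idempotent. *)
Lemma eps_mul (R : comPzRingType) (I J : ideal R) :
  eps (mul_ideal I J) = mul_ideal (eps I) (eps J).
Proof.
apply: ideal_eqP; split; last first.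
  apply: eps_max; first by apply: mul_idempotents; exact: eps_idempotent.
  by apply: mul_ideal_mono; exact: eps_sub.
have /idempotentsP <- := eps_idempotent (mul_ideal I J).
apply: mul_ideal_mono; apply: eps_mono; last rewrite mul_idealC;
  exact: mul_ideal_subl.
Qed.

Lemma eps_id (R : comPzRingType) (I : ideal R) :
  idempotents (ideal R) I -> eps I = I.
Proof.
by move=> EI; apply: ideal_eqP; split; [exact: eps_sub|exact: eps_max].
Qed.

(** * Nakayama's lemma and idempotent ideals *)

Lemma is_ideal_addM (R : comPzRingType) (J K : ideal R) (a : R) :
  is_ideal [set x | exists2 j, J j & K (x - j * a)].
Proof.
split=> [|x y [j Jj Kx] [k Jk Ky]|r x [j Jj Kx]].
- by exists 0; rewrite ?mul0r ?subr0; exact: ideal0.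
- exists (j + k); first exact: idealD.
  have -> : x + y - (j + k) * a = (x - j * a) + (y - k * a) by ring.
  exact: idealD.
- exists (r * j); first exact: idealMl.
  by rewrite -mulrA -mulrBr; exact: idealMl.
Qed.

(* The ideal [J a + K]. *)
Definition addM_ideal (R : comPzRingType) (J : ideal R) (a : R) (K : ideal R) :=
  Ideal (is_ideal_addM J K a).

Definition colon_ideal (R : comPzRingType) (K : ideal R) (a : R) : ideal R :=
  Ideal (is_ideal_colon K a).

(* The first hypothesis says that [s] lies in the ideal [J s + K], expressed as
   the intersection of the ideals containing it. *)
Lemma nakayama (R : comPzRingType) (J K : ideal R) (s : seq R) :
  (forall L : ideal R, K `<=` L ->
     (forall j y, J j -> y \in s -> L (j * y)) -> forall y, y \in s -> L y) ->
  exists2 e, J e & forall y, y \in s -> K ((1 - e) * y).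
Proof.
elim: s K => [|a s IHs] K hs; first by exists 0; [exact: ideal0|].
have KK' : K `<=` addM_ideal J a K.
  by move=> x Kx; exists 0; [exact: ideal0|rewrite mul0r subr0].
have Ja j : J j -> addM_ideal J a K (j * a).
  by move=> Jj; exists j => //; rewrite subrr; exact: ideal0.
have [L K'L hL y ys|e Je he] := IHs (addM_ideal J a K).
  apply: (hs L) => [x /KK' /K'L //|j z Jj|]; last by rewrite inE ys orbT.
  by rewrite inE => /predU1P[->|]; [apply: K'L; exact: Ja|exact: hL].
(* By [he], the ideal (J a + K) : (1 - e) meets the condition in [hs], so it contains [a]. *)
have [j Jj Kj] : colon_ideal (addM_ideal J a K) (1 - e) a.
  apply: hs (mem_head a s) => [x /KK' /(idealMl (1 - e)) //|j z Jj].
  rewrite inE => /predU1P[->|zs]; first exact: (idealMl (1 - e) (Ja j Jj)).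
  apply: (idealMl (I := colon_ideal _ _)); exact: he.
have Kc : K ((1 - e - j) * a) by rewrite mulrBl.
(* Chosen so that its complement is (1 - e - j)(1 - e): the second factor moves [s] into J a + K,
   the first moves [a] into [K]. *)
exists (e + (e + j) * (1 - e)).
  by apply: idealD => //; apply: idealMr; exact: idealD.
have -> : 1 - (e + (e + j) * (1 - e)) = (1 - e - j) * (1 - e) by ring.
move=> y; rewrite inE => /predU1P[->|ys].
  by rewrite mulrAC; exact: idealMr.
have [k Jk Kk] := he y ys.
have -> : (1 - e - j) * (1 - e) * y =
    (1 - e - j) * ((1 - e) * y - k * a) + k * ((1 - e - j) * a) by ring.
by apply: idealD; exact: idealMl.
Qed.

(** Nakayama with [K] zero, applied to generators of J = J J, gives [e] in [J] with (1 - e) J = 0;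
    such an [e] is idempotent and generates [J]. *)
Lemma idempotent_ideal_principal (R : comPzRingType) (J : ideal R) :
  noetherian R -> idempotents (ideal R) J ->
  exists2 f : R, f * f = f & J = principal f.
Proof.
move=> noeR /idempotentsP EJ; have [s Js] := noeR J.
have sJ y : y \in s -> J y by move=> ys; rewrite Js; exact: sub_gen_ideal.
have [L _ hL y ys|e Je he] := nakayama (J := J) (K := principal 0) (s := s).
  have : mul_ideal J J y by move: (sJ y ys); rewrite -{1}EJ.
  apply: mul_ideal_sub => j z Jj; rewrite {1}Js.
  by apply: (gen_ideal_sub (I := colon_ideal L j)) => x xs; exact: hL.
have eJ y : J y -> (1 - e) * y = 0.
  move=> Jy; suff /mem_principal[r ->] : principal 0 ((1 - e) * y).
    by rewrite mulr0.
  move: Jy; rewrite {1}Js.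
  by apply: (gen_ideal_sub (I := colon_ideal (principal 0) (1 - e))).
exists e; first by have /eqP := eJ e Je; rewrite mulrBl mul1r subr_eq0 => /eqP.
apply: ideal_eqP; split; last exact: principal_sub.
move=> y Jy; apply/mem_principal; exists y.
by have /eqP := eJ y Jy; rewrite mulrBl mul1r subr_eq0 mulrC => /eqP.
Qed.

(** * Noetherian induction and finite length *)

(* [l] bounds the length of chains of ideals above [B]. *)
Definition length_above (R : comPzRingType) (B : ideal R) (l : ideal R -> nat) :=
  forall I J : ideal R, B `<=` I -> I `<=` J -> ~ J `<=` I -> (l J < l I)%N.

Lemma length_above_le (R : comPzRingType) (B I J : ideal R) l :
  length_above B l -> B `<=` I -> I `<=` J -> (l J <= l I)%N.
Proof.
move=> hl BI IJ; have [JI|nJI] := pselect (J `<=` I).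
  by have -> : I = J by exact: ideal_eqP.
by apply: ltnW; exact: hl.
Qed.

(** A counterexample starts a strictly ascending chain of counterexamples; its union is finitely
    generated, hence equal to one of its terms. *)
Lemma noetherian_ind (R : comPzRingType) (P : ideal R -> Prop) :
  noetherian R ->
  (forall B : ideal R, (forall C : ideal R, B `<=` C -> ~ C `<=` B -> P C) -> P B) ->
  forall B, P B.
Proof.
move=> noeR IH B; apply: contrapT => nPB.
have next (C : ideal R) : exists C' : ideal R,
    ~ P C -> [/\ C `<=` C', ~ C' `<=` C & ~ P C'].
  have [PC|nPC] := pselect (P C); first by exists C.
  apply: contrapT => nC'; apply: (nPC); apply: IH => C' CC' nC'C.
  by apply: contrapT => nPC'; apply: nC'; exists C'.
have [f hf] := choice next.
pose c n := iter n f B.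
have nPc n : ~ P (c n) by elim: n => //= n /hf[].
have cmono m n : (m <= n)%N -> c m `<=` c n.
  move=> /subnK <-; elim: (n - m)%N => // k IHk.
  by apply: subset_trans IHk _; have [] := hf _ (nPc (k + m)%N).
have cup : is_ideal [set x | exists n, c n x].
  split=> [|x y [m cx] [n cy]|r x [n cx]].
  - by exists 0%N; exact: ideal0.
  - exists (maxn m n); apply: idealD.
      by apply: cmono cx; exact: leq_maxl.
    by apply: cmono cy; exact: leq_maxr.
  - by exists n; exact: idealMl.
have [s hs] := noeR (Ideal cup).
have [n hn] : exists n, forall x, x \in s -> c n x.
  have : forall x, x \in s -> exists n, c n x.
    by move=> x xs; suff : Ideal cup x by []; rewrite hs; exact: sub_gen_ideal.
  elim: s {hs} => [|a s IHs] h; first by exists 0%N.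
  have [x xs|m hm] := IHs; first by apply: h; rewrite inE xs orbT.
  have [k hk] := h a (mem_head _ _).
  exists (maxn m k) => x; rewrite inE => /predU1P[->|/hm hx].
    by apply: cmono hk; exact: leq_maxr.
  by apply: cmono hx; exact: leq_maxl.
have [_ + _] := hf _ (nPc n); apply=> x fx.
have : Ideal cup x by exists n.+1.
by rewrite hs; apply: gen_ideal_sub => y /hn.
Qed.

Lemma exists_length_above (S : idomainType) (B : ideal S) :
  dedekind_domain S -> (exists2 x, B x & x != 0) ->
  exists l, length_above B l.
Proof.
move=> [noeS _ primemax]; move: B.
apply: (noetherian_ind noeS) => B IH nzB.
have [B1|nB1] := pselect (B 1).
  exists (fun=> 0%N) => I J BI IJ []; move=> x _.
  by rewrite -[x]mulr1; apply: idealMl; exact: BI.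
have [pB|npB] := pselect (prime_ideal B).
  have [_ maxB] := primemax B pB nzB.
  (* Maximality leaves only [B] and the unit ideal above [B]. *)
  exists (fun I => if `[< I 1 >] then 0%N else 1%N) => I J BI IJ nJI.
  case: asboolP => J1; case: asboolP => I1 //.
  - by case: nJI => x _; rewrite -[x]mulr1; exact: idealMl.
  - by case: J1; exact: IJ.
  - by case: nJI; rewrite (maxB I) // (maxB J) //; exact: subset_trans IJ.
have [a [b [Bab nBa nBb]]] : exists a b, [/\ B (a * b), ~ B a & ~ B b].
  apply: contrapT => nab; apply: npB; split=> // a b Bab.
  have [Ba|nBa] := pselect (B a); first by left.
  have [Bb|nBb] := pselect (B b); first by right.
  by case: nab; exists a, b.
pose U : ideal S := principal 1.
have U1 r : U r by apply/mem_principal; exists r; rewrite mulr1.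
have [x0 Bx0 x00] := nzB.
have BC : B `<=` addM_ideal U a B.
  by move=> x Bx; exists 0; rewrite ?mul0r ?subr0.
have BD : B `<=` colon_ideal B a by move=> x; exact: idealMl.
have [||l1 hl1] := IH _ BC.
- by move=> CB; apply/nBa/CB; exists 1; rewrite ?mul1r ?subrr //; exact: ideal0.
- by exists x0 => //; exact: BC.
have [||l2 hl2] := IH _ BD.
- by move=> /(_ b Bab).
- by exists x0 => //; exact: BD.
(* As [U] is the unit ideal, this adds the lengths of I + (a) and I : a. A strict inclusion stays
   strict in at least one of them. *)
exists (fun I => (l1 (addM_ideal U a I) + l2 (colon_ideal I a))%N).
move=> I J BI IJ nJI.
have BI1 : addM_ideal U a B `<=` addM_ideal U a I.
  by move=> x [r Ur /BI]; exists r.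
have BI2 : colon_ideal B a `<=` colon_ideal I a by move=> x /BI.
have IJ1 : addM_ideal U a I `<=` addM_ideal U a J.
  by move=> x [r Ur /IJ]; exists r.
have IJ2 : colon_ideal I a `<=` colon_ideal J a by move=> x /IJ.
have [JI1|nJI1] := pselect (addM_ideal U a J `<=` addM_ideal U a I); last first.
  rewrite -addSn leq_add //; first exact: hl1.
  exact: length_above_le hl2 BI2 IJ2.
have [JI2|nJI2] := pselect (colon_ideal J a `<=` colon_ideal I a); last first.
  rewrite -addnS leq_add //; last exact: hl2.
  exact: length_above_le hl1 BI1 IJ1.
(* Here neither ideal changes. Write x = r a modulo [I]; then r a is in [J], so [r] is in J : a,
   hence in I : a, and [x] is in [I]. *)
case: nJI => x Jx.
have [r _ Ir] : addM_ideal U a I x.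
  by apply: JI1; exists 0; rewrite ?mul0r ?subr0.
have Ira : I (a * r).
  apply: JI2 => /=; rewrite -(subKr x (a * r)); apply: idealB => //.
  by rewrite mulrC; exact: IJ.
by rewrite -(subrK (r * a) x); apply: idealD => //; rewrite mulrC.
Qed.

(** * Passage to the quotient ring *)

Lemma is_ideal_comap (S : idomainType) (A : ideal S) (I : ideal (quotient_ring A)) :
  is_ideal [set x | I (qpi A x)].
Proof.
split=> [|x y Ix Iy|r x Ix] /=.
- have -> : qpi A 0 = 0 by rewrite /qpi raddf0.
  exact: ideal0.
- by rewrite qpiD; exact: idealD.
- by rewrite qpiM; exact: (idealMl (I := I)).
Qed.

Definition comap_ideal (S : idomainType) (A : ideal S)
  (I : ideal (quotient_ring A)) : ideal S := Ideal (is_ideal_comap I).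

Lemma noetherian_quotient (S : idomainType) (A : ideal S) :
  noetherian S -> noetherian (quotient_ring A).
Proof.
move=> noeS I; have [s hs] := noeS (comap_ideal I).
exists (map (qpi A) s); apply: ideal_eqP; split; last first.
  apply: gen_ideal_sub => _ /mapP[x xs ->].
  by suff : comap_ideal I x by []; rewrite hs; exact: sub_gen_ideal.
move=> u Iu; have [x xu] := qpi_surj u; rewrite -xu in Iu *.
have : comap_ideal I x by [].
rewrite hs; set G := gen_ideal [set` map _ _].
suff : gen_ideal [set` s] `<=` comap_ideal G by apply.
by apply: gen_ideal_sub => y ys; apply: sub_gen_ideal; exact: map_f.
Qed.

(** Together with noetherianity, all that is later used of the origin of [R] as a quotient of a
    Dedekind domain. *)
Definition finite_length_above_nonzero (R : comPzRingType) :=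
  forall x : R, x != 0 -> exists l, length_above (principal x) l.

(** Preimages keep strict inclusions because [qpi] is surjective, and a lift of a nonzero [u] is a
    nonzero element of the preimage of (u). *)
Lemma quotient_finite_length (S : idomainType) (A : ideal S) :
  dedekind_domain S -> finite_length_above_nonzero (quotient_ring A).
Proof.
move=> dedS u; have [x <-] := qpi_surj u => nzx.
have [|l hl] := exists_length_above (B := comap_ideal (principal (qpi A x))) dedS.
  exists x; first exact: principal_id.
  by apply: contra_neq nzx => ->; rewrite /qpi raddf0.
exists (fun I => l (comap_ideal I)) => I J xI IJ nJI; apply: hl.
- by move=> y /xI.
- by move=> y /IJ.
- move=> JI; apply: nJI => v; have [y <-] := qpi_surj v; exact: JI.
Qed.

(** * The idempotent acts as identity on the base *)

Section Ring.
Variable R : comPzRingType.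
Hypothesis flR : finite_length_above_nonzero R.

Lemma principal_idempotent (f : R) :
  f * f = f -> idempotents (ideal R) (principal f).
Proof.
by move=> ff; apply/idempotentsP; rewrite mul_principal ff.
Qed.

Lemma partial_product_strict (f p b : R) :
  f * f = f -> p != 0 -> (1 - f) * p = p -> eps (principal b) = principal f ->
  ~ principal p `<=` principal (p * b).
Proof.
move=> ff nzp fp eb /(_ p (principal_id p)) /mem_principal[r pE].
have pb n : principal (b ^+ n) p.
  apply/mem_principal; exists (r ^+ n * p).
  elim: n => [|n IHn]; first by rewrite !expr0 mul1r mulr1.
  by rewrite {1}pE {1}IHn !exprS; ring.
have [l hl] := flR nzp.
(* Positivity of [n] puts (b^n) inside (b), as [eps_max] will require. *)
have [n n0 [t ht]] : exists2 n, (0 < n)%N & exists t, b ^+ n = t * b ^+ n.+1.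
  apply: contrapT => nst.
  have grow n : (n <= l (principal (b ^+ n.+1)))%N.
    elim: n => // n IHn; apply: leq_ltn_trans IHn _; apply: hl.
    - by apply: principal_sub; exact: pb.
    - apply: principal_sub; apply/mem_principal.
      by exists b; rewrite [in LHS]exprS.
    - move=> /(_ _ (principal_id _))/mem_principal[t ht].
      by apply: nst; exists n.+1 => //; exists t.
  (* Every (b^n) contains (p), so the value at exponent l(p) + 2 is at most l(p), while [grow] makes
     it at least l(p) + 1. *)
  have := length_above_le hl (fun _ h => h) (principal_sub (pb (l (principal p)).+2)).
  by rewrite leqNgt (leq_trans _ (grow _)).
have stab k : b ^+ n = t ^+ k * b ^+ (n + k).
  elim: k => [|k {1}->]; first by rewrite expr0 mul1r addn0.
  by rewrite exprD {1}ht addnS !exprS exprD; ring.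
(* The case k = n of [stab] puts b^n in (b^(2n)). *)
have idem : idempotents (ideal R) (principal (b ^+ n)).
  apply/idempotentsP; rewrite mul_principal; apply: ideal_eqP; split.
    by apply: principal_sub; apply/mem_principal; exists (b ^+ n).
  by apply: principal_sub; apply/mem_principal; exists (t ^+ n);
    rewrite -exprD -stab.
have : principal f p.
  rewrite -eb; apply: (eps_max idem) (pb n).
  apply: principal_sub; apply/mem_principal; exists (b ^+ n.-1).
  by rewrite -exprSr prednK.
move=> /mem_principal[s ps]; move/eqP: nzp; apply.
by rewrite -fp ps mulrCA mulrBl mul1r ff subrr mulr0.
Qed.

(** The partial products generate a strictly descending chain of ideals containing [y], so each
    element of [s] costs at least one unit of [l]. They are nonzero because they divide [y]. *)
Lemma foldl_mul_bound (f p y : R) (s : seq R) l :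
  f * f = f -> y != 0 -> length_above (principal y) l ->
  (1 - f) * p = p -> {in s, forall b, eps (principal b) = principal f} ->
  foldl *%R p s = y -> principal p y /\ (l (principal p) + size s <= l (principal y))%N.
Proof.
move=> ff nzy hl; elim: s p => [|b s IHs] p fp hs /= py.
  by rewrite -py addn0; split=> //; exact: principal_id.
have fpb : (1 - f) * (p * b) = p * b by rewrite mulrA fp.
have hs' : {in s, forall c, eps (principal c) = principal f}.
  by move=> c cs; apply: hs; rewrite inE cs orbT.
have [ypb hpb] := IHs _ fpb hs' py.
have pbp : principal (p * b) `<=` principal p.
  by apply: principal_sub; apply/mem_principal; exists b; rewrite mulrC.
split; first exact: pbp.
have nzp : p != 0.
  apply: contraNneq nzy => p0; have [r ->] := (mem_principal _ _).1 ypb.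
  by rewrite p0 mul0r mulr0.
rewrite addnS -addSn; apply: leq_trans hpb; rewrite leq_add2r; apply: hl pbp _.
  exact: principal_sub.
by apply: (partial_product_strict ff nzp fp); apply: hs; exact: mem_head.
Qed.

Lemma mul_foldl (c a : R) (s : seq R) :
  c * foldl *%R a s = foldl *%R (c * a) s.
Proof. by elim: s a => //= b s IHs a; rewrite IHs mulrA. Qed.

Lemma Base_eps_class_fixed (f x : R) :
  f * f = f -> Base (eps_class (principal f)) x -> f * x = x.
Proof.
move=> ff Bx; apply: contrapT => nfx.
have nzy : (1 - f) * x != 0.
  by apply/eqP; rewrite mulrBl mul1r => /eqP; rewrite subr_eq0 => /eqP/esym.
have [l hl] := flR nzy.
(* One factor is [a], leaving l(y) + 1 in [s], one more than [foldl_mul_bound] permits. *)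
have [a [s [[size_s] hs xE]]] := Bx (l (principal ((1 - f) * x))).+2 isT.
have [|||_] := foldl_mul_bound (p := (1 - f) * a) (s := s) ff nzy hl.
- by rewrite mulrA mulrBl mul1r mulrBr mulr1 ff subrr subr0.
- by move=> b bs; apply: hs; rewrite inE bs orbT.
- by rewrite -mul_foldl xE.
by rewrite size_s addnS ltnNge leq_addl.
Qed.

End Ring.

(** * Each class is a stratified extension of a group *)

Lemma setpow_idem_mull (R : comPzRingType) (X : set (mult_semigroup R)) (f y : R) m :
  f * y = y -> X f -> X y -> setpow X m.+1 y.
Proof.
move=> fy Xf Xy; exists y, (nseq m f); split.
- by rewrite /= size_nseq.
- by move=> z; rewrite inE => /predU1P[->//|/nseqP[-> _]].
- elim: m => //= m IHm; rewrite {1}IHm; congr foldl.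
  by rewrite -[LHS]fy -[RHS]mulrC.
Qed.

(** Absorbing [y] into the last factor keeps the number of factors; this makes [Base] closed under
    products. *)
Lemma setpow_mulr (T : semigroupType) (X : set T) m (x y : T) :
  subsemigroup X -> setpow X m x -> X y -> setpow X m (x * y)%g.
Proof.
move=> mulX [a [s [sm hs ->]]] Xy.
have [s0|[t [b sE]]] : s = [::] \/ exists t b, s = rcons t b.
- by case/lastP: s {sm hs} => [|t b]; [left|right; exists t, b].
- exists (a * y)%g, [::]; split=> //; first by rewrite -sm s0.
    by move=> z; rewrite inE => /eqP ->; apply: mulX => //; apply: hs; exact: mem_head.
  by rewrite s0.
- exists a, (rcons t (b * y)%g); split; first by rewrite -sm sE /= !size_rcons.
    move=> z; rewrite inE mem_rcons inE => /or3P[/eqP ->|/eqP ->|zt].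
    + by apply: hs; exact: mem_head.
    + by apply: mulX => //; apply: hs; rewrite sE inE mem_rcons mem_head orbT.
    + by apply: hs; rewrite sE inE mem_rcons inE zt !orbT.
  by rewrite sE -!cats1 !foldl_cat /= mulgA.
Qed.

Lemma eps_classM (R : comPzRingType) (e e' : ideal R) (x y : R) :
  eps_class e x -> eps_class e' y -> eps_class (mul_ideal e e') (x * y).
Proof.
by rewrite /eps_class /= -mul_principal eps_mul => -> ->.
Qed.

Lemma eps_class_subsemigroup (R : comPzRingType) (e : ideal R) :
  idempotents (ideal R) e -> subsemigroup (eps_class e).
Proof.
move=> /idempotentsP Ee x y ex ey.
by have := eps_classM ex ey; rewrite Ee.
Qed.

Lemma eps_class_idempotent (R : comPzRingType) (f : R) :
  f * f = f -> eps_class (principal f) f.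
Proof. by move=> ff; exact/eps_id/principal_idempotent. Qed.

Lemma eps_class_stratified (R : comPzRingType) (f : R) :
  finite_length_above_nonzero R -> f * f = f ->
  stratified_extension_of_group (eps_class (principal f)).
Proof.
move=> flR ff; have ef := eps_class_idempotent ff.
have BaseI (y : R) : f * y = y -> eps_class (principal f) y ->
    Base (eps_class (principal f)) y.
  by move=> fy ey [//|m] _; exact: setpow_idem_mull fy ef ey.
have Bf := BaseI f ff ef.
have subX := eps_class_subsemigroup (principal_idempotent ff).
have BaseX (x : R) : Base (eps_class (principal f)) x -> eps_class (principal f) x.
  move=> /(_ 1%N isT)[a [s [s1 hs ->]]].
  by case: s s1 hs => // _ hs; apply: hs; exact: mem_head.
split; first by exists f.
split; first by move=> x y Bx By m m0; apply: setpow_mulr (Bx m m0) (BaseX y By).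
exists f => // x Bx; have fx := Base_eps_class_fixed flR ff Bx.
split=> //; first by rewrite -[RHS]fx; exact: mulrC.
(* As [x] lies in the class, (f) is [eps (principal x)], which is contained in (x). *)
have [z fE] : exists z, f = z * x.
  apply/mem_principal; apply: (@eps_sub R (principal x)).
  by rewrite (BaseX x Bx); exact: principal_id.
have fzx : f * z * x = f by rewrite -mulrA -fE.
(* The factor [f] brings the inverse into the class: f z x = f gives (f z) = (f). *)
exists (f * z); last by split; [rewrite -[RHS]fzx; exact: mulrC|].
apply: BaseI; first by rewrite mulrA ff.
rewrite /eps_class /=; have -> : principal (f * z) = principal f.
  apply: ideal_eqP; split; apply: principal_sub; apply/mem_principal.
    by exists z; rewrite mulrC.
  by exists x; rewrite mulrC.
exact: ef.
Qed.

End Development.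

Theorem theorem4p10 (S : idomainType) (A : ideal S) :
  dedekind_domain S ->
  let R : comPzRingType := quotient_ring A in
  let ED : set (ideal R) := idempotents (ideal R) in
  semilattice_of_semigroups (T := mult_semigroup R) ED (@eps_class R) /\
  (forall e : ideal R, ED e ->
     stratified_extension_of_group (T := mult_semigroup R) (eps_class e)).
Proof.
move=> dedS R ED; have [noeS _ _] := dedS.
have EDE (e : ideal R) : ED e -> exists2 f : R, (f * f)%R = f & e = principal f.
  exact: idempotent_ideal_principal (noetherian_quotient noeS).
split; last first.
  by move=> _ /EDE[f ff ->]; apply: eps_class_stratified ff; exact: quotient_finite_length.
split.
  split=> [e e'|e e' _ _|//]; [exact: mul_idempotents|exact: mul_idealC].
split.
- by apply/seteqP; split=> // x _; exists (eps (principal x)) => //; exact: eps_idempotent.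
- by move=> e e' _ _ [x [/= <- <-]].
- move=> e Ee; split; last exact: eps_class_subsemigroup.
  by have [f ff ->] := EDE e Ee; exists f; exact: eps_class_idempotent.
- by move=> e e' _ _ x y; exact: eps_classM.
Qed.
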